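(* For every integer $m\ge 3$, $N_m\ge 2m-1$.
   Context: For integers $1\le m\le n$ and a binary string $\mathbf{x}=x_1\dots x_n\in\{0,1\}^n$, let $P(m,\mathbf{x})$ denote the probability distribution on $\{0,1\}^m$ of the random string $x_{i_1}x_{i_2}\dots x_{i_m}$, where the indices $1\le i_1<\dots<i_m\le n$ are chosen uniformly at random among all $\binom{n}{m}$ such choices (i.e. a uniformly random $m$-element subset of positions is kept, with the order preserved). Let $R(m,n)$ denote the statement that the map $\mathbf{x}\mapsto P(m,\mathbf{x})$ on $\{0,1\}^n$ is one-to-one. Define $N_m:=\sup\{n : n\ge m,\ R(m,n)\text{ holds}\}$, the supremum being taken over integers $n$ and a priori valued in $\mathbb{N}\cup\{\infty\}$. *)

(* Defs.v *)
From mathcomp Require Import all_boot all_order all_algebra.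
From mathcomp Require Import all_classical all_reals ereal.

Set Implicit Arguments.
Unset Strict Implicit.
Unset Printing Implicit Defensive.

Import Order.TTheory GRing.Theory Num.Theory.

Local Open Scope classical_set_scope.
Local Open Scope ring_scope.

(* Positions are numbered 0, ..., n-1. There are 'C(n, m) increasing index
   tuples, by card_ltn_sorted_tuples. *)
Definition index_choices (m n : nat) : {set m.-tuple 'I_n} :=
  [set i : m.-tuple 'I_n | sorted ltn (map val i)]%SET.

Definition subword (m n : nat) (x : n.-tuple bool) (i : m.-tuple 'I_n) :
    m.-tuple bool :=
  [tuple tnth x (tnth i k) | k < m].

(* The distribution P(m, x), given by its probability mass function. *)
Definition subword_distr (R : realType) (m n : nat) (x : n.-tuple bool) :
    {ffun m.-tuple bool -> R} :=
  [ffun y => #|[set i in index_choices m n | subword x i == y]%SET|%:R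
             / 'C(n, m)%:R].

Definition reconstructible (R : realType) (m n : nat) : Prop :=
  injective (fun x : n.-tuple bool => subword_distr R m x).

(* The set below always contains m, so that the supremum is never -oo; it
   is +oo exactly when the set is unbounded. *)
Definition N_ (R : realType) (m : nat) : \bar R :=
  ereal_sup [set (n%:R)%:E | n in [set n : nat |
                               (m <= n)%N /\ reconstructible R m n]].

(* Main.v *)
Require Import Defs.
From mathcomp Require Import all_boot all_order all_algebra.
From mathcomp Require Import all_classical all_reals ereal.

Set Implicit Arguments.
Unset Strict Implicit.
Unset Printing Implicit Defensive.

Import GRing.Theory Num.Theory.

(** The distribution P(m, x) records how often each word of length m occurs in
    x as a subsequence. These numbers determine how often any word w of length
    at most m occurs: every occurrence of w in x extends to the same number
    'C(|x| - |w|, m - |w|) of sets of m positions, so averaging the number of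
    occurrences of w over the subsequences of length m recovers that of w in x
    ([sum_occ_choices]).

    Let |x| = 2m - 1. One of the two letters, say c, occurs t <= m - 1 times in
    x, and the other letter d fills the t + 1 gaps before, between and after
    the copies of c. An occurrence in x of c^i d c^(t - i), a word of
    length t + 1 <= m, has to use every copy of c in x and so is the choice of
    one d in the gap number i: the number of occurrences is the length of that
    gap. Since t is itself the number of occurrences of the one-letter word c,
    the distribution determines x ([occ_gap_word_inj]). *)

(** * Counting occurrences of a word as a subsequence *)

(** One entry for each set of [k] positions of [s], so that a word occurring
    several times is listed with multiplicity. *)
Fixpoint choices {T : Type} (k : nat) (s : seq T) : seq (seq T) :=
  match k, s with
  | 0, _ => [:: [::]]
  | _.+1, [::] => [::]
  | k'.+1, a :: s' => map (cons a) (choices k' s') ++ choices k s'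
  end.

Definition occ {T : eqType} (w x : seq T) : nat :=
  count_mem w (choices (size w) x).

Lemma choices0 (T : Type) (s : seq T) : choices 0 s = [:: [::]].
Proof. by case: s. Qed.

Lemma map_choices (T U : Type) (f : T -> U) k s :
  choices k (map f s) = map (map f) (choices k s).
Proof.
elim: s k => [|a s IHs] [|k] //=.
by rewrite map_cat !IHs -!map_comp.
Qed.

Lemma mem_choices (T : eqType) k (s y : seq T) :
  (y \in choices k s) = subseq y s && (size y == k).
Proof.
elim: s k y => [|a s IHs] [|k] [|b y] //=; rewrite ?inE ?andbF //.
  by rewrite mem_cat IHs andbF orbF; apply/mapP => -[].
rewrite mem_cat IHs eqSS; case: (eqVneq b a) => [->|neq_ba].
  rewrite mem_map ?IHs; last by move=> u v [].
  case: (size y == k); rewrite ?andbF // !andbT.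
  apply/orP/idP => [[//|]|->]; last by left.
  exact/subseq_trans/subseq_cons.
case: mapP => //= -[u _ [eq_ba _]].
by rewrite eq_ba eqxx in neq_ba.
Qed.

Lemma uniq_choices (T : eqType) k (s : seq T) :
  uniq s -> uniq (choices k s).
Proof.
elim: s k => [|a s IHs] [|k] //= /andP[aNs s_uniq].
rewrite cat_uniq map_inj_uniq ?IHs //=; last by move=> u v [].
rewrite andbT; apply/hasPn => y; rewrite mem_choices => /andP[sub_ys _].
apply/mapP => -[u _ y_eq]; move: aNs; rewrite (mem_subseq sub_ys) //.
by rewrite y_eq mem_head.
Qed.

Lemma occ_nil (T : eqType) (x : seq T) : occ [::] x = 1.
Proof. by rewrite /occ choices0. Qed.

Lemma occ_cons (T : eqType) b (w : seq T) a x :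
  occ (b :: w) (a :: x) = (a == b) * occ w x + occ (b :: w) x.
Proof.
rewrite /occ /= count_cat count_map; congr (_ + _).
case: eqVneq => [->|neq_ab]; rewrite ?mul1n ?mul0n.
  by apply: eq_count => y /=; rewrite eqseq_cons eqxx.
rewrite -(count_pred0 (choices (size w) x)); apply: eq_count => y /=.
by rewrite eqseq_cons (negPf neq_ab).
Qed.

Lemma occ_eq0 (T : eqType) (w x : seq T) : ~~ subseq w x -> occ w x = 0.
Proof. by move=> wNx; apply/count_memPn; rewrite mem_choices (negPf wNx). Qed.

Lemma occ_size_eq0 (T : eqType) (w x : seq T) : size x < size w -> occ w x = 0.
Proof.
move=> lt_xw; apply: occ_eq0; apply: contraL lt_xw => /size_subseq.
by rewrite -leqNgt.
Qed.

Lemma occ_count_eq0 (T : eqType) (a : pred T) (w x : seq T) :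
  count a x < count a w -> occ w x = 0.
Proof.
move=> lt_xw; apply: occ_eq0; apply: contraL lt_xw => /leq_count_subseq le_wx.
by rewrite -leqNgt.
Qed.

Lemma occ_seq1 (T : eqType) (c : T) x : occ [:: c] x = count_mem c x.
Proof. by elim: x => [|a x IHx] //; rewrite occ_cons occ_nil muln1 IHx. Qed.

(** Both sides count the pairs of an occurrence of [w] in [x] and a set of [m]
    positions of [x] containing it. *)
Lemma sum_occ_choices (T : eqType) m (w x : seq T) : size w <= m ->
  \sum_(y <- choices m x) occ w y
    = occ w x * 'C(size x - size w, m - size w).
Proof.
elim: x m w => [|a x IHx] [|m] w.
- by case: w => // _; rewrite big_seq1 !occ_nil.
- by case: w => [|b w] _; rewrite big_nil ?bin0n.
- by case: w => // _; rewrite big_seq1 !occ_nil bin0.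
move=> le_wm; rewrite /= big_cat big_map /= (IHx m.+1) //.
case: w le_wm => [_|b w le_wm].
  have -> : \sum_(y <- choices m x) occ [::] (a :: y)
          = \sum_(y <- choices m x) occ [::] y.
    by apply: eq_bigr => y _; rewrite !occ_nil.
  by rewrite IHx // !occ_nil !subn0 !mul1n binS addnC.
under eq_bigr do rewrite occ_cons.
rewrite big_split /= -big_distrr /= IHx // occ_cons mulnDl !subSS -!addnA.
rewrite -mulnA; congr (_ + _).
move: le_wm; rewrite /= ltnS leq_eqVlt => /predU1P[<-|lt_wm].
  (* [b :: w] is too long to occur in a subsequence of length [m]. *)
  rewrite subnn !bin0 big_seq big1 // => y.
  rewrite mem_choices => /andP[_ /eqP size_y].
  by apply: occ_size_eq0; rewrite size_y.
rewrite IHx //=; have [lt_xw|lt_wx] := leqP (size x) (size w).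
  by rewrite occ_size_eq0.
rewrite -mulnDr; congr (_ * _).
by rewrite -(subnSK lt_wx) -(subnSK lt_wm) binS addnC.
Qed.

(** The factor in [sum_occ_choices] depends on [x] only through its length, and
    it is positive as soon as [m <= size x], so it can be divided out. *)
Lemma perm_choices_occ (T : eqType) m (w x x' : seq T) :
    size w <= m -> m <= size x -> size x = size x' ->
  perm_eq (choices m x) (choices m x') -> occ w x = occ w x'.
Proof.
move=> le_wm le_mx size_xx' eq_deck; apply/eqP.
have bin_gt0 : 0 < 'C(size x - size w, m - size w).
  by rewrite bin_gt0 leq_sub2r.
rewrite -(eqn_pmul2r bin_gt0) -sum_occ_choices // (perm_big _ eq_deck) /=.
by rewrite sum_occ_choices // size_xx'.
Qed.

(** * Reading off the gaps between the occurrences of a letter *)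

Definition gap_word (c : bool) (t i : nat) : seq bool :=
  nseq i c ++ ~~ c :: nseq (t - i) c.

Lemma size_gap_word c t i : i <= t -> size (gap_word c t i) = t.+1.
Proof. by move=> le_it; rewrite size_cat /= !size_nseq addnS subnKC. Qed.

Lemma count_gap_word c t i : i <= t -> count_mem c (gap_word c t i) = t.
Proof.
move=> le_it; rewrite count_cat /= !count_nseq /= eqxx !mul1n.
by case: c; rewrite add0n subnKC.
Qed.

(** The only occurrence uses every copy of [c]. *)
Lemma occ_nseq_count (T : eqType) (c : T) (x : seq T) :
  occ (nseq (count_mem c x) c) x = 1.
Proof.
elim: x => [|a x IHx]; first by rewrite occ_nil.
rewrite [count_mem c _]/=; case: eqVneq => [->|neq_ac].
  rewrite occ_cons eqxx mul1n IHx (@occ_count_eq0 _ (pred1 c)) //=.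
  by rewrite count_nseq /= eqxx mul1n.
rewrite add0n; case: (count_mem c x) IHx => [|k] IHx; first by rewrite occ_nil.
by rewrite occ_cons (negPf neq_ac) mul0n.
Qed.

Lemma occ_gap_word_head c t x : t = (count_mem c x).+1 ->
  occ (gap_word c t 0) (c :: x) = 0.
Proof.
move=> t_eq; rewrite occ_cons [X in _ + X](@occ_count_eq0 _ (pred1 c)).
  by case: c t_eq.
by rewrite [X in _ < X](@count_gap_word c t 0) // t_eq.
Qed.

(** An occurrence skipping the first [c] would lack a copy of [c], so gap
    [i.+1] of [c :: x] is gap [i] of [x]. *)
Lemma occ_gap_word_cons c x i : i <= count_mem c x ->
  occ (gap_word c (count_mem c x).+1 i.+1) (c :: x)
    = occ (gap_word c (count_mem c x) i) x.
Proof.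
move=> le_it; set t := count_mem c x.
have gapS : gap_word c t.+1 i.+1 = c :: gap_word c t i by [].
rewrite gapS occ_cons eqxx mul1n -gapS.
by rewrite [X in _ + X](@occ_count_eq0 _ (pred1 c)) ?addn0 ?count_gap_word.
Qed.

(** The new letter extends gap 0, with the copies of [c] after it matched in
    the only possible way. *)
Lemma occ_gap_word_consN c x i :
  occ (gap_word c (count_mem c x) i) (~~ c :: x)
    = (i == 0) + occ (gap_word c (count_mem c x) i) x.
Proof.
case: i => [|i]; rewrite /gap_word /= occ_cons; last by case: c.
by rewrite eqxx subn0 occ_nseq_count.
Qed.

(** The counts are the lengths of the gaps, so the one for gap 0 tells which
    letter comes first. Removing that letter shortens gap 0 by one, or shifts
    the numbering of the gaps, in the same way in both sequences. *)
Lemma occ_gap_word_inj c x x' :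
    size x = size x' -> count_mem c x = count_mem c x' ->
    (forall i, i <= count_mem c x ->
       occ (gap_word c (count_mem c x) i) x
         = occ (gap_word c (count_mem c x) i) x') ->
  x = x'.
Proof.
elim: x x' => [|a x IHx] [|a' x'] //= [size_xx'].
case: (eqVneq a c) => [->|a_neq]; case: (eqVneq a' c) => [->|a'_neq];
  rewrite ?add1n ?add0n.
- move=> [t_eq] occ_eq; congr (_ :: _); apply: IHx => // i le_it.
  by rewrite -occ_gap_word_cons // occ_eq // t_eq occ_gap_word_cons // -t_eq.
- have -> : a' = ~~ c by case: (a') (c) a'_neq => -[].
  move=> t_eq /(_ 0 isT); rewrite occ_gap_word_head // t_eq.
  by rewrite occ_gap_word_consN.
- have -> : a = ~~ c by case: (a) (c) a_neq => -[].
  move=> t_eq /(_ 0 isT).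
  by rewrite occ_gap_word_head // occ_gap_word_consN.
have -> : a = ~~ c by case: (a) (c) a_neq => -[].
have -> : a' = ~~ c by case: (a') (c) a'_neq => -[].
move=> t_eq occ_eq; congr (_ :: _); apply: IHx => // i le_it.
apply: (@addnI (i == 0)); rewrite -occ_gap_word_consN occ_eq //.
by rewrite t_eq occ_gap_word_consN.
Qed.

(** * From distributions to occurrences *)

(** This identifies the increasing tuples of positions with the members of
    [choices m (enum 'I_n)]. *)
Lemma sorted_ord_subseq n (s : seq 'I_n) :
  sorted ltn (map val s) = subseq s (enum 'I_n).
Proof.
apply/idP/idP => [s_sorted|sub_s].
  have ltn_irr : irreflexive ltn by exact: ltnn.
  have -> : s = [seq i <- enum 'I_n | i \in s]; last exact: filter_subseq.
  apply: (inj_map val_inj); apply: (irr_sorted_eq ltn_trans) => //.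
    rewrite (subseq_sorted ltn_trans (map_subseq _ (filter_subseq _ _))) //.
    by rewrite val_enum_ord iota_ltn_sorted.
  by apply: eq_mem_map => i; rewrite mem_filter mem_enum andbT.
apply: (subseq_sorted ltn_trans (map_subseq _ sub_s)).
by rewrite val_enum_ord iota_ltn_sorted.
Qed.

Lemma val_subword m n (x : n.-tuple bool) (i : m.-tuple 'I_n) :
  subword x i = map (tnth x) i :> seq bool.
Proof. by rewrite /= -[in RHS](map_tnth_enum i) -map_comp. Qed.

(** Listing [x] as the image of its positions makes [choices m x] the image of
    the increasing [m]-tuples of positions. *)
Lemma card_subword_occ m n (x : n.-tuple bool) (y : m.-tuple bool) :
  #|[set i in index_choices m n | subword x i == y]%SET| = occ y x.
Proof.
rewrite /occ size_tuple -[in RHS](map_tnth_enum x) map_choices count_map.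
rewrite -size_filter cardE -(size_map val); apply/perm_size/uniq_perm.
- by rewrite map_inj_uniq ?enum_uniq //; exact: val_inj.
- by rewrite filter_uniq ?uniq_choices ?enum_uniq.
move=> s; rewrite mem_filter mem_choices -sorted_ord_subseq.
apply/mapP/and3P => [[i]|[/eqP xs_y s_sorted size_s]].
  rewrite mem_enum !inE => /andP[i_sorted /eqP xi_y] ->.
  split=> //; last by rewrite size_tuple.
  by apply/eqP; rewrite -xi_y; exact/esym/val_subword.
exists (Tuple size_s) => //; rewrite mem_enum !inE s_sorted /=.
by apply/eqP/val_inj/(etrans (val_subword x _)).
Qed.

Lemma subword_distr_perm (R : realType) m n (x x' : n.-tuple bool) : m <= n ->
  subword_distr R m x = subword_distr R m x' ->
  perm_eq (choices m x) (choices m x').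
Proof.
move=> le_mn /ffunP eq_distr; rewrite /perm_eq.
apply/allP => y; rewrite mem_cat !mem_choices => y_in.
have size_y : size y == m by case/orP: y_in => /andP[].
have := eq_distr (Tuple size_y); rewrite !ffunE !card_subword_occ /occ /=.
have bin_neq0 : ('C(n, m)%:R != 0 :> R)%R by rewrite pnatr_eq0 -lt0n bin_gt0.
move=> /(divIf bin_neq0) /eqP.
by rewrite eqr_nat (eqP size_y).
Qed.

Lemma reconstructible_2m_subn1 (R : realType) m : 0 < m ->
  reconstructible R m (2 * m - 1).
Proof.
move=> m_gt0 x x'; set n := 2 * m - 1 in x x' *.
have le_mn : m <= n by rewrite /n mul2n -addnn -addnBA // leq_addr.
move=> /(subword_distr_perm le_mn) eq_deck.
have occ_eq w : size w <= m -> occ w x = occ w x'.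
  by move=> le_wm; apply: perm_choices_occ eq_deck; rewrite ?size_tuple.
have [c lt_cm] : exists c, count_mem c x < m.
  have [|le_m] := ltnP (count_mem true x) m; first by exists true.
  exists false; rewrite -(ltn_add2l (count_mem true x)).
  have -> : count_mem false x = count (predC (pred1 true)) x.
    by apply: eq_count => -[].
  rewrite count_predC size_tuple; apply: leq_trans (leq_add le_m (leqnn m)).
  by rewrite /n mul2n -addnn subn1 ltn_predL addn_gt0 m_gt0.
apply/val_inj/(@occ_gap_word_inj c).
- by rewrite !size_tuple.
- by rewrite -!occ_seq1 occ_eq.
by move=> i le_it; rewrite occ_eq // size_gap_word.
Qed.

Theorem theorem6 (R : realType) (m : nat) (hm : (3 <= m)%N) :
  (((2 * m - 1)%N%:R)%:E <= N_ R m)%E.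
Proof.
have m_gt0 : 0 < m by exact: leq_trans hm.
apply: ereal_sup_ubound; exists (2 * m - 1) => //; split.
  by rewrite mul2n -addnn -addnBA // leq_addr.
exact: reconstructible_2m_subn1.
Qed.
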